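(* Let $A,B,C$ be integers with $ABC\neq 0$ and let $f(X)=AX+B+\frac{C}{X}$. Then the equation $f(x)f(y)=f(z)^2$ has infinitely many nontrivial rational solutions $(x,y,z)$.
   Context: A solution $(x,y,z)$ (with $x,y,z$ nonzero rationals, so that $f$ is defined) of $f(x)f(y)=f(z)^2$ is called nontrivial if $f(x)\neq f(y)$ and $f(z)\neq 0$. *)

(* Defs.v *)
From mathcomp Require Import all_boot all_order all_algebra.
Set Implicit Arguments. Unset Strict Implicit. Unset Printing Implicit Defensive.
Import Order.TTheory GRing.Theory Num.Theory.
Local Open Scope ring_scope.

Definition fABC (A B C : int) (x : rat) : rat :=
  A%:~R * x + B%:~R + C%:~R / x.

Definition nontrivial_sol (A B C : int) (t : rat * rat * rat) : Prop :=
  let: (x, y, z) := t in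
  [/\ x != 0, y != 0 & z != 0] /\
  fABC A B C x * fABC A B C y = fABC A B C z ^+ 2 /\
  fABC A B C x != fABC A B C y /\
  fABC A B C z != 0.

(* Main.v *)
(* Replacing X by (B/A)X reduces f to B (v + 1 + k/v) with k = AC/B^2.
   On the slice x = pz, y = z/p the equation becomes m p z^2 + (p+1)^2 z + p = 0
   with m = 1/k, which is solvable in z iff (p+1)^4 - 4 m p^2 is a square.  This
   quartic in p is covered by the elliptic curve v^2 = u (u^2 - m u + m), which
   carries the point P = (m, m).  A small multiple of P has an even denominator
   unless m is 1, -1 or 3 (where P is torsion), and then repeated doubling makes
   the 2-adic valuation of u decrease strictly; so no appeal to Mazur's theorem
   is needed.  For the three remaining values of k one fixes z instead: the
   solutions with given z form another curve of genus one, on which a suitable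
   choice of z yields a point with even denominator. *)

Require Import Defs.
From mathcomp Require Import all_boot all_order all_algebra.
From mathcomp Require Import zify ring lra.
Import GRing.Theory Num.Theory.
Set Implicit Arguments. Unset Strict Implicit. Unset Printing Implicit Defensive.
Local Open Scope ring_scope.

(** * Infinite predicates *)

Definition infinitely_many (T : eqType) (P : T -> Prop) : Prop :=
  forall s : seq T, exists2 x, P x & x \notin s.

Lemma infinitely_many_image (T U : eqType) (P : T -> Prop) (Q : U -> Prop)
    (f : T -> U) (g : U -> T) :
  infinitely_many P -> (forall x, P x -> Q (f x)) ->
  (forall x, P x -> g (f x) = x) -> infinitely_many Q.
Proof.
move=> infP PQ fK s; have [x Px xNs] := infP (map g s).
exists (f x); first exact: PQ.
by apply: contra xNs => fx_s; rewrite -(fK x Px) map_f.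
Qed.

Lemma infinitely_many_uniq (T : eqType) (P : T -> Prop) n :
  infinitely_many P ->
  exists s : seq T, [/\ uniq s, size s = n & forall x, x \in s -> P x].
Proof.
move=> infP; elim: n => [|n [s [s_uniq <- sP]]]; first by exists [::].
have [x Px xNs] := infP s; exists (x :: s); split=> //=; first by rewrite xNs.
by move=> y; rewrite inE => /orP[/eqP->|/sP].
Qed.

(** Turns finitely many degenerate cases into roots of one polynomial. The list to avoid is absorbed
    as further linear factors, so a single root count settles both demands. *)
Lemma infinitely_many_nonroot (F : fieldType) (P : F -> Prop) (p : {poly F}) :
  p != 0 -> infinitely_many P -> infinitely_many (fun x => P x /\ p.[x] != 0).
Proof.
move=> p_neq0 infP s.
pose r := p * \prod_(a <- s) ('X - a%:P).
have r_neq0 : r != 0.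
  by rewrite mulf_neq0 // prodf_seq_neq0; apply/allP=> a _; rewrite polyXsubC_eq0.
have [s' [s'_uniq size_s' s'P]] := infinitely_many_uniq (size r) infP.
have [rootr|/allPn[x xs']] := boolP (all (root r) s').
  by have := max_poly_roots r_neq0 rootr s'_uniq; rewrite size_s' ltnn.
rewrite rootM root_prod_XsubC negb_or => /andP[px xNs].
by exists x => //; split => //; apply: s'P.
Qed.

(** * Doubling and 2-adic growth on y^2 = x^3 + a x^2 + b x *)

Definition on_curve (a b : int) (x : rat) : Prop :=
  exists y : rat, y ^+ 2 = x ^+ 3 + a%:~R * x ^+ 2 + b%:~R * x.

Definition oddz (n : int) : bool := ~~ (2 %| n)%Z.

Lemma oddzP (n : int) : reflect (exists m, n = 2 * m + 1) (oddz n).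
Proof.
apply: (iffP idP) => [n_odd|[m ->]]; last by rewrite /oddz; lia.
by exists (n %/ 2)%Z; move: n_odd; rewrite /oddz; lia.
Qed.

Lemma oddz_neq0 (n : int) : oddz n -> n != 0.
Proof. by apply: contraTneq => ->. Qed.

(** Duplication formula by the tangent at (x, y), with [w] standing for y^2; [w != 0] says that the
    point is not 2-torsion. The witness is, up to sign, the ordinate of the double. *)
Lemma double_on_curve (a b : int) (x : rat) :
  let w := x ^+ 3 + a%:~R * x ^+ 2 + b%:~R * x in
  on_curve a b x -> w != 0 -> on_curve a b ((x ^+ 2 - b%:~R) ^+ 2 / (4 * w)).
Proof.
move=> w [y yE] w_neq0.
have y_neq0 : y != 0 by apply: contraNneq w_neq0 => y0; rewrite /w -yE y0 expr0n.
exists ((x ^+ 2 - b%:~R) * (x ^+ 4 + 2 * a%:~R * x ^+ 3 + 6 * b%:~R * x ^+ 2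
   + 2 * a%:~R * b%:~R * x + b%:~R ^+ 2) / (8 * y ^+ 3)).
set e := _ * (x ^+ 4 + _ + _ + _ + _).
have -> : (e / (8 * y ^+ 3)) ^+ 2 = e ^+ 2 / (64 * (y ^+ 2) ^+ 3) by field.
by rewrite yE /e /w; rewrite /w in w_neq0; field.
Qed.

Lemma oddz_sqrB (b p q : int) : oddz p -> (2 %| q)%Z -> oddz (p ^+ 2 - b * q ^+ 2).
Proof.
move=> /oddzP[r ->] /dvdzP[t ->]; apply/oddzP.
by exists (2 * r ^+ 2 + 2 * r - 2 * b * t ^+ 2); ring.
Qed.

Lemma oddz_quadratic (a b p q : int) :
  oddz p -> (2 %| q)%Z -> oddz (p * (p ^+ 2 + a * p * q + b * q ^+ 2)).
Proof.
move=> /oddzP[r ->] /dvdzP[t ->]; apply/oddzP.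
exists (4 * r ^+ 3 + 6 * r ^+ 2 + 3 * r + a * (2 * r + 1) ^+ 2 * t
  + 2 * b * (2 * r + 1) * t ^+ 2); ring.
Qed.

Lemma oddz_sqr n : oddz n -> oddz (n ^+ 2).
Proof.
by move=> /oddzP[r ->]; apply/oddzP; exists (2 * r ^+ 2 + 2 * r); ring.
Qed.

Lemma oddzM (m n : int) : oddz m -> oddz n -> oddz (m * n).
Proof.
move=> /oddzP[r ->] /oddzP[t ->]; apply/oddzP.
by exists (2 * r * t + r + t); ring.
Qed.

Lemma oddz_double_sub (m n : int) : oddz n -> oddz (2 * m - n).
Proof. by rewrite /oddz; lia. Qed.

Lemma double_fraction (a b p q : int) :
  let d := p * (p ^+ 2 + a * p * q + b * q ^+ 2) in
  on_curve a b (p%:~R / q%:~R) -> q != 0 -> d != 0 ->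
  on_curve a b (((p ^+ 2 - b * q ^+ 2) ^+ 2)%:~R / (4 * q * d)%:~R).
Proof.
move=> d on_pq q_neq0 d_neq0.
have qr : q%:~R != 0 :> rat by rewrite intr_eq0.
have dr : d%:~R != 0 :> rat by rewrite intr_eq0.
move: (double_on_curve on_pq).
set w := (_ + _ + _).
have wE : w = d%:~R / q%:~R ^+ 3 by rewrite /w /d !(rmorphD, rmorphM, rmorphXn) /=; field.
rewrite wE mulf_neq0 ?invr_eq0 ?expf_neq0 // => /(_ isT).
congr on_curve.
rewrite !(rmorphB, rmorphXn, rmorphM) /=; rewrite -/d.
field; move: dr.
by rewrite /d !(rmorphD, rmorphM, rmorphXn) /= mulf_eq0 negb_or qr => /andP[-> ->].
Qed.

(* If x = p/q with p odd and q even, then x(2P) = (p^2 - b q^2)^2 / (4 q (...)) has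
   odd numerator and a denominator with two more factors 2. *)
Lemma iter_double (a b p q : int) (n : nat) :
  on_curve a b (p%:~R / q%:~R) -> oddz p -> (2 %| q)%Z -> q != 0 ->
  exists p' q' : int, [/\ on_curve a b (p'%:~R / q'%:~R), oddz p',
    (2 ^+ n.+1 %| q')%Z & q' != 0].
Proof.
move=> on_pq p_odd q_even q_neq0.
elim: n => [|n [p' [q' [on_pq' p'_odd q'_div q'_neq0]]]]; first by exists p, q.
have q'_even : (2 %| q')%Z by apply: dvdz_trans q'_div; rewrite exprS dvdz_mulr.
have d_neq0 := oddz_neq0 (oddz_quadratic a b p'_odd q'_even).
exists ((p' ^+ 2 - b * q' ^+ 2) ^+ 2),
  (4 * q' * (p' * (p' ^+ 2 + a * p' * q' + b * q' ^+ 2))).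
split.
- exact: double_fraction.
- exact/oddz_sqr/oddz_sqrB.
- by rewrite exprS dvdz_mulr // dvdz_mul.
- by rewrite mulf_neq0 // mulf_neq0.
Qed.

(** Since p is odd, reducing p / q to lowest terms cancels only odd factors. *)
Lemma dvdz_denq (x : rat) (p q : int) (n : nat) :
  x = p%:~R / q%:~R -> q != 0 -> oddz p -> (2 ^+ n %| q)%Z -> (2 ^+ n %| denq x)%Z.
Proof.
move=> xE q_neq0 p_odd q_div.
have qr : q%:~R != 0 :> rat by rewrite intr_eq0.
have dr : (denq x)%:~R != 0 :> rat by rewrite intr_eq0 denq_neq0.
have /intr_inj eq_pd : (p * denq x)%:~R = (numq x * q)%:~R :> rat.
  by rewrite !rmorphM /=; apply/eqP; rewrite -eqr_div // divq_num_den xE.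
have : (2 ^+ n %| p * denq x)%Z by rewrite eq_pd dvdz_mull.
rewrite Gauss_dvdzr //; apply: coprimezXl.
by move: p_odd; rewrite coprimezE coprime2n /oddz dvdzE dvdn2 negbK.
Qed.

(** The oddness hypothesis concerns the numerator of the double of p / q, whose denominator carries
    a factor 4. Iterated doubling from there gives denominators divisible by arbitrarily high powers
    of 2. *)
Lemma infinitely_many_on_curve (a b p q : int) :
  on_curve a b (p%:~R / q%:~R) -> oddz (p ^+ 2 - b * q ^+ 2) -> q != 0 ->
  p * (p ^+ 2 + a * p * q + b * q ^+ 2) != 0 ->
  infinitely_many (on_curve a b).
Proof.
move=> on_pq num_odd q_neq0 d_neq0 s.
(* This sum bounds every denominator in [s], and 2^(n+1) exceeds it. *)
pose n := (\sum_(x <- s) `|denq x|)%N.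
have [||||p' [q' [on_pq' p'_odd q'_div q'_neq0]]] := @iter_double a b
    ((p ^+ 2 - b * q ^+ 2) ^+ 2)
    (4 * q * (p * (p ^+ 2 + a * p * q + b * q ^+ 2))) n.
- exact: double_fraction.
- exact: oddz_sqr.
- by rewrite -mulrA dvdz_mulr.
- by rewrite mulf_neq0 // mulf_neq0.
exists (p'%:~R / q'%:~R) => //; apply/negP => x_s.
have := dvdz_denq erefl q'_neq0 p'_odd q'_div.
rewrite /dvdz => /dvdn_leq; rewrite absz_gt0 denq_neq0 => /(_ isT).
rewrite abszX leqNgt => /negP; apply.
apply: leq_ltn_trans (ltn_expl n.+1 _) => //; apply: leqW.
by rewrite /n (big_rem _ x_s) /= leq_addr.
Qed.

(** * From cubics to quartics *)

Lemma infinitely_many_affine (F : fieldType) (P Q : F -> Prop) (a b : F) :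
  a != 0 -> infinitely_many P -> (forall x, P x -> Q (a * x + b)) ->
  infinitely_many Q.
Proof.
move=> a_neq0 infP PQ.
by apply: (infinitely_many_image (g := fun y => (y - b) / a) infP PQ) => x _; field.
Qed.

(* The cubic is the resolvent of the quartic: completing the square with
   y = al t^2 + h1 t / (2 al) - U / (2 al) leaves a quadratic equation in t whose
   discriminant is, up to a square factor, the cubic evaluated at U. *)
Lemma infinitely_many_quartic (al h1 h2 h3 h4 : rat) : al != 0 ->
  infinitely_many (fun U => exists V, V ^+ 2 =
     U ^+ 3 + h2 * U ^+ 2 + (h1 * h3 - 4 * al ^+ 2 * h4) * U
     + (al ^+ 2 * h3 ^+ 2 + h1 ^+ 2 * h4 - 4 * al ^+ 2 * h2 * h4)) ->
  infinitely_many (fun t => exists y, y ^+ 2 =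
     al ^+ 2 * t ^+ 4 + h1 * t ^+ 3 + h2 * t ^+ 2 + h3 * t + h4).
Proof.
move=> al0 inf_cubic s.
(* For fixed t the equation [key] below is quadratic in U: up to a constant it is [r t]. So only
   finitely many U lead to a t in [s]. *)
pose r (t : rat) : {poly rat} := 'X ^+ 2 - (4 * al ^+ 2 * t ^+ 2 + 2 * h1 * t) *: 'X
  + ((h1 * t) ^+ 2 - 4 * al ^+ 2 * (h2 * t ^+ 2 + h3 * t + h4))%:P.
have rE t U : (r t).[U] = U ^+ 2 - (4 * al ^+ 2 * t ^+ 2 + 2 * h1 * t) * U
  + ((h1 * t) ^+ 2 - 4 * al ^+ 2 * (h2 * t ^+ 2 + h3 * t + h4)).
  by rewrite /r !(hornerD, hornerN, hornerZ, hornerXn, hornerX, hornerC).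
have r_neq0 t : r t != 0.
  apply/eqP => /(congr1 (fun q : {poly rat} => q`_2)).
  by rewrite !(coefD, coefN, coefZ, coefC, coefX, coefXn) /= mulr0 oppr0 !addr0.
pose e := h2 - h1 ^+ 2 / (4 * al ^+ 2).
have p_neq0 : ('X + e%:P) * \prod_(t <- s) r t != 0.
  rewrite mulf_neq0 //; first by rewrite -size_poly_eq0 size_XaddC.
  by rewrite prodf_seq_neq0; apply/allP => t _; rewrite r_neq0.
have [U [[V VE]]] := infinitely_many_nonroot p_neq0 inf_cubic [::].
rewrite hornerM hornerD hornerX hornerC mulf_eq0 negb_or horner_prod => /andP[Ue rU] _.
have h2E : h2 = e + h1 ^+ 2 / (4 * al ^+ 2) by rewrite /e; field.
clearbody e.
(* Quadratic formula, with V / al as root of the discriminant; U + e is the leading coefficient,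
   hence was kept nonzero. *)
pose t := (V / al - h3 - h1 * U / (2 * al ^+ 2)) / (2 * (U + e)).
have key : (U + e) * t ^+ 2 + (h3 + h1 * U / (2 * al ^+ 2)) * t + h4
    - U ^+ 2 / (4 * al ^+ 2) = 0.
  have -> : (U + e) * t ^+ 2 + (h3 + h1 * U / (2 * al ^+ 2)) * t + h4
      - U ^+ 2 / (4 * al ^+ 2) =
      (V ^+ 2 / al ^+ 2 - (h3 + h1 * U / (2 * al ^+ 2)) ^+ 2) / (4 * (U + e))
      + h4 - U ^+ 2 / (4 * al ^+ 2) by rewrite /t; field; rewrite al0 Ue.
  by rewrite VE h2E; field; rewrite al0 Ue.
clearbody t.
exists t.
  exists (al * t ^+ 2 + h1 / (2 * al) * t - U / (2 * al)).
  by apply/eqP; rewrite -subr_eq0 -oppr_eq0 -[X in _ == X]key h2E; apply/eqP; field.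
apply: contra rU => t_s; rewrite (big_rem _ t_s) /= mulf_eq0 rE.
apply/orP; left; rewrite -[X in _ == X](mulr0 (- 4 * al ^+ 2)) -key h2E; apply/eqP.
by field.
Qed.

(** * Normal form and the two families of solutions *)

Definition lau (k v : rat) : rat := v + 1 + k / v.

Definition lau_sol (k : rat) (t : rat * rat * rat) : Prop :=
  let: (x, y, z) := t in
  [/\ x != 0, y != 0 & z != 0] /\
  lau k x * lau k y = lau k z ^+ 2 /\
  lau k x != lau k y /\
  lau k z != 0.

Lemma lau_sol_scale (A B C : int) : A * B * C != 0 ->
  infinitely_many (lau_sol ((A * C)%:~R / B%:~R ^+ 2)) ->
  infinitely_many (nontrivial_sol A B C).
Proof.
rewrite !mulf_eq0 !negb_or -andbA => /and3P[A0 B0 C0] inf_k.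
have a0 : A%:~R != 0 :> rat by rewrite intr_eq0.
have b0 : B%:~R != 0 :> rat by rewrite intr_eq0.
have c0 : C%:~R != 0 :> rat by rewrite intr_eq0.
pose l : rat := B%:~R / A%:~R.
have l0 : l != 0 by rewrite mulf_neq0 ?invr_eq0.
have fE v : v != 0 -> fABC A B C (l * v) =
    B%:~R * lau ((A * C)%:~R / B%:~R ^+ 2) v.
  by move=> v0; rewrite /fABC /lau /l rmorphM /=; field; rewrite v0 b0 a0.
clearbody l.
apply: (infinitely_many_image
  (f := fun t : rat * rat * rat => (l * t.1.1, l * t.1.2, l * t.2))
  (g := fun t : rat * rat * rat => (t.1.1 / l, t.1.2 / l, t.2 / l)) inf_k).
  move=> [[x y] z] /= [[x0 y0 z0] [eq_f [neq_f fz]]].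
  rewrite !mulf_neq0 //; split=> //.
  rewrite !fE //; split; first by rewrite exprMn -eq_f; ring.
  split; first by rewrite (inj_eq (mulfI b0)).
  by rewrite mulf_neq0.
by move=> [[x y] z] _ /=; congr (_, _, _); field.
Qed.

(** Given x and z, clearing denominators in the equation leaves a quadratic in y. Its discriminant
    is the displayed quartic divided by (x^2 + x + k)^2. *)
Lemma lau_sol_fixed_z (k z : rat) :
  k != 0 -> z != 0 -> lau k z != 0 ->
  infinitely_many (fun x => exists W, W ^+ 2 =
    (lau k z ^+ 2 * x - (x ^+ 2 + x + k)) ^+ 2 - 4 * k * (x ^+ 2 + x + k) ^+ 2) ->
  infinitely_many (lau_sol k).
Proof.
move=> k0 z0 c0 inf_x s; set c := lau k z in c0 inf_x *.
pose N : {poly rat} := 'X ^+ 2 + 'X + k%:P.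
have sizeN : size N = 3.
  by rewrite /N -addrA size_polyDl size_polyXn // size_XaddC.
have N_neq0 : N != 0 by rewrite -size_poly_eq0 sizeN.
have lin_neq0 (e : rat) : N - e *: 'X != 0.
  apply/eqP => /(congr1 (fun q : {poly rat} => q`_2)).
  by rewrite !(coefB, coefN, coefD, coefZ, coefC, coefX, coefXn) /= mulr0 oppr0 !addr0.
(* Roots of [N] have f(x) = 0; the next two factors vanish where f(x) = c or f(x) = -c, the cases
   with f(x) = f(y). *)
have p_neq0 : 'X * N * (N - c *: 'X) * (N - (- c) *: 'X)
    * \prod_(t <- s) ('X - t.1.1%:P) != 0.
  rewrite !mulf_neq0 ?polyX_eq0 //.
  by rewrite prodf_seq_neq0; apply/allP => t _; rewrite polyXsubC_eq0.
have [x [[W WE]]] := infinitely_many_nonroot p_neq0 inf_x [::].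
rewrite !hornerE horner_prod !mulf_eq0 !negb_or -!andbA.
set n := _ + k => /and5P[x0 n0 nc nNc xs] _.
pose y := (c ^+ 2 * x / n - 1 + W / n) / 2.
have y_eq : y ^+ 2 + (1 - c ^+ 2 * x / n) * y + k = 0.
  have -> : y ^+ 2 + (1 - c ^+ 2 * x / n) * y + k =
    (W ^+ 2 - (c ^+ 2 * x - n) ^+ 2 + 4 * k * n ^+ 2) / (4 * n ^+ 2).
    by rewrite /y; field.
  by rewrite WE /n; field.
have y0 : y != 0.
  by apply: contraNneq k0 => y0; move: y_eq; rewrite y0; lra.
have fx : lau k x = n / x by rewrite /lau /n; field.
have fy : lau k y = c ^+ 2 * x / n.
  have -> : lau k y = (y ^+ 2 + (1 - c ^+ 2 * x / n) * y + k) / y + c ^+ 2 * x / n.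
    by rewrite /lau; field; rewrite y0 n0.
  by rewrite y_eq mul0r add0r.
exists (x, y, z).
  split=> //; rewrite -/c fx fy; split; first by field; rewrite x0 n0.
  split=> //; apply/eqP => eq_f.
  have /eqP : (n - c * x) * (n + c * x) = 0.
    have -> : (n - c * x) * (n + c * x) = n * x * (n / x - c ^+ 2 * x / n) by field; rewrite x0 n0.
    by rewrite eq_f subrr mulr0.
  rewrite mulf_eq0 (negPf nc) /=.
  by move: nNc; rewrite mulNr opprK => /negPf->.
by apply: contra xs => xs; rewrite (big_rem _ xs) /= !hornerE subrr mul0r.
Qed.

(* Here t = p + 1 and the solution is (p z, z / p, z). *)
Lemma lau_sol_geometric (m : rat) : m != 0 ->
  infinitely_many (fun t => exists y, y ^+ 2 =
     t ^+ 4 - 4 * m * t ^+ 2 + 8 * m * t - 4 * m) ->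
  infinitely_many (lau_sol m^-1).
Proof.
move=> m0 inf_t s.
pose r1 : {poly rat} := 'X ^+ 2 - m *: 'X + m%:P.
pose r2 : {poly rat} := 'X ^+ 4 - (4 * m) *: 'X ^+ 2 + (8 * m) *: 'X - (4 * m)%:P.
have r1_neq0 : r1 != 0.
  apply/eqP => /(congr1 (fun q : {poly rat} => q`_2)).
  by rewrite !(coefD, coefN, coefZ, coefC, coefX, coefXn) /= mulr0 oppr0 !addr0.
have r2_neq0 : r2 != 0.
  apply/eqP => /(congr1 (fun q : {poly rat} => q`_4)).
  by rewrite !(coefD, coefN, coefZ, coefC, coefX, coefXn) /= !mulr0 oppr0 !addr0.
(* t = 0 and t = 2 force f(x) = f(y), and t = 1 means p = 0. [r1] vanishes if f(z) = 0, [r2] if Y =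
   0, which m z^2 = 1 would imply. The product excludes the ratios x / z found in [s]. *)
have p_neq0 : 'X * ('X - 1%:P) * ('X - 2%:P) * r1 * r2
    * \prod_(t <- s) ('X - (t.1.1 / t.2 + 1)%:P) != 0.
  rewrite !mulf_neq0 ?polyX_eq0 ?polyXsubC_eq0 //.
  by rewrite prodf_seq_neq0; apply/allP => t _; rewrite polyXsubC_eq0.
have [t [[Y YE]]] := infinitely_many_nonroot p_neq0 inf_t [::].
rewrite !hornerM !hornerXsubC hornerX horner_prod.
have -> : r1.[t] = t ^+ 2 - m * t + m.
  by rewrite /r1 !(hornerD, hornerN, hornerZ, hornerXn, hornerX, hornerC).
have -> : r2.[t] = t ^+ 4 - 4 * m * t ^+ 2 + 8 * m * t - 4 * m.
  by rewrite /r2 !(hornerD, hornerN, hornerZ, hornerXn, hornerX, hornerC).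
rewrite !mulf_eq0 !negb_or -!andbA => /and5P[t0 p0 p1 r1t /andP[r2t ts]] _.
pose z := (Y - t ^+ 2) / (2 * m * (t - 1)).
have z_eq : m * (t - 1) * z ^+ 2 + t ^+ 2 * z + (t - 1) = 0.
  have -> : m * (t - 1) * z ^+ 2 + t ^+ 2 * z + (t - 1) =
    (Y ^+ 2 - t ^+ 4) / (4 * m * (t - 1)) + (t - 1) by rewrite /z; field; rewrite m0 p0.
  by rewrite YE; field; rewrite m0 p0.
have z0 : z != 0.
  by apply: contraNneq p0 => z0; move: z_eq; rewrite z0; lra.
have Y0 : Y != 0.
  by apply: contraNneq r2t => Y0; move: YE; rewrite Y0; lra.
have mz0 : m * z != 0 by exact: mulf_neq0.
have YzE : Y = 2 * m * (t - 1) * z + t ^+ 2 by rewrite /z; field; rewrite m0 p0.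
clearbody z.
exists ((t - 1) * z, z / (t - 1), z).
  split; first by rewrite !mulf_neq0 ?invr_eq0.
  split; last split.
  - apply/eqP; rewrite -subr_eq0.
    have -> : lau m^-1 ((t - 1) * z) * lau m^-1 (z / (t - 1)) - lau m^-1 z ^+ 2 =
      (t - 2) ^+ 2 / (m * z * (t - 1) ^+ 2)
        * (m * (t - 1) * z ^+ 2 + t ^+ 2 * z + (t - 1)).
      by rewrite /lau; field; rewrite m0 p0 z0.
    by rewrite z_eq mulr0.
  - rewrite -subr_eq0.
    have -> : lau m^-1 ((t - 1) * z) - lau m^-1 (z / (t - 1)) =
      t * (t - 2) / (t - 1) * ((m * z ^+ 2 - 1) / (m * z)).
      by rewrite /lau; field; rewrite m0 p0 z0.
    rewrite mulf_neq0 //; first by rewrite !mulf_neq0 ?invr_eq0.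
    rewrite mulf_neq0 ?invr_eq0 //.
    apply: contra Y0 => /eqP mz.
    have /eqP : Y * z = 0.
      rewrite YzE.
      have -> : (2 * m * (t - 1) * z + t ^+ 2) * z =
        m * (t - 1) * z ^+ 2 + t ^+ 2 * z + (t - 1) + (t - 1) * (m * z ^+ 2 - 1) by ring.
      by rewrite z_eq mz mulr0 addr0.
    by rewrite mulf_eq0 (negPf z0) orbF.
  - have -> : lau m^-1 z = (m * z ^+ 2 + m * z + 1) / (m * z).
      by rewrite /lau; field; rewrite m0 z0.
    rewrite mulf_neq0 ?invr_eq0 //.
    apply: contra r1t => /eqP mz.
    have /eqP : (t ^+ 2 - m * t + m) * z = 0.
      have -> : (t ^+ 2 - m * t + m) * z = m * (t - 1) * z ^+ 2 + t ^+ 2 * z + (t - 1)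
        - (t - 1) * (m * z ^+ 2 + m * z + 1) by ring.
      by rewrite z_eq mz mulr0 subr0.
    by rewrite mulf_eq0 (negPf z0) orbF.
apply: contra ts => ts; rewrite (big_rem _ ts) /= mulf_eq0 hornerXsubC /=.
by rewrite mulfK // subrK subrr eqxx.
Qed.

(* The right-hand side of [lau_sol_fixed_z] takes the square value al^2 at x = z
   and has Taylor coefficients h1, ..., h4 there; r translates the rational root
   of the resolvent to 0. *)
Lemma lau_sol_fixed_z_curve (k z : rat) :
  k != 0 -> z != 0 -> lau k z != 0 -> z ^+ 2 - k != 0 ->
  infinitely_many (fun x => exists y, y ^+ 2 = x ^+ 3
    + ((lau k z ^+ 2 - 1) ^+ 2 - 8 * k + 16 * k ^+ 2) * x ^+ 2
    + 16 * k ^+ 2 * lau k z ^+ 4 * x) ->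
  infinitely_many (lau_sol k).
Proof.
move=> k0 z0 c0 zk inf_E; apply: (lau_sol_fixed_z k0 z0 c0).
set c := lau k z in c0 inf_E *.
have cE : c = (z ^+ 2 + z + k) / z by rewrite /c /lau; field.
pose al := c * (z ^+ 2 - k).
have al0 : al != 0 by rewrite mulf_neq0.
pose n1 := 2 * z + 1.
pose h1 := 2 * c * z * ((c - 1) * (c ^+ 2 - n1) - 4 * k * n1).
pose h2 := (c ^+ 2 - n1) ^+ 2 - 2 * c * z * (c - 1) - 4 * k * (n1 ^+ 2 + 2 * c * z).
pose h3 := - 2 * (c ^+ 2 - n1) - 8 * k * n1.
pose h4 := 1 - 4 * k.
pose r := ((c ^+ 2 - 1) ^+ 2 - 8 * k + 16 * k ^+ 2 - h2) / 3.
have inf_t : infinitely_many (fun t => exists y, y ^+ 2 =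
     al ^+ 2 * t ^+ 4 + h1 * t ^+ 3 + h2 * t ^+ 2 + h3 * t + h4).
  apply: infinitely_many_quartic => //.
  apply: (infinitely_many_affine (a := 1) (b := r) _ inf_E) => // x [y yE].
  exists y; rewrite yE /r /al /h1 /h2 /h3 /h4 /n1 cE; field.
  by [].
have X_neq0 : 'X != 0 :> {poly rat} by rewrite polyX_eq0.
(* The trivial solution x = y = z explains the square value at x = z. Putting t = 1 / (x - z) sends
   that point to infinity, so [al ^+ 2] becomes the leading coefficient. *)
apply: (infinitely_many_image (f := fun t => z + t^-1) (g := fun x => (x - z)^-1)
  (infinitely_many_nonroot X_neq0 inf_t)) => t [[y yE]]; rewrite hornerX => t0.
  exists (y / t ^+ 2).
  rewrite expr_div_n yE /al /h1 /h2 /h3 /h4 /n1 cE; field.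
  by rewrite z0 t0.
by rewrite addrC addKr invrK.
Qed.

(** Scaling x by l^2 and y by l^3 makes the coefficients integral, so that the 2-adic criterion
    applies. *)
Lemma lau_sol_fixed_z_int (k z l : rat) (a b p q : int) :
  k != 0 -> z != 0 -> lau k z != 0 -> z ^+ 2 - k != 0 -> l != 0 ->
  a%:~R = l ^+ 2 * ((lau k z ^+ 2 - 1) ^+ 2 - 8 * k + 16 * k ^+ 2) ->
  b%:~R = l ^+ 4 * (16 * k ^+ 2 * lau k z ^+ 4) ->
  on_curve a b (p%:~R / q%:~R) -> oddz (p ^+ 2 - b * q ^+ 2) -> q != 0 ->
  p * (p ^+ 2 + a * p * q + b * q ^+ 2) != 0 ->
  infinitely_many (lau_sol k).
Proof.
move=> k0 z0 c0 zk l0 aE bE on_pq num_odd q0 d0.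
apply: (lau_sol_fixed_z_curve k0 z0 c0 zk).
have inf_x := infinitely_many_on_curve on_pq num_odd q0 d0.
apply: (infinitely_many_affine (a := l ^- 2) (b := 0) _ inf_x) => [|x [y yE]].
  by rewrite invr_eq0 expf_neq0.
by exists (y / l ^+ 3); rewrite expr_div_n yE aE bE; field.
Qed.

(** * A suitable multiple of P for generic m *)

(* The curve is V^2 = U (U^2 - M D U + M D^3), i.e. v^2 = u (u^2 - m u + m) with
   m = M / D, U = D^2 u and V = D^3 v. *)
Lemma infinitely_many_product_curve (M D : int) :
  ~~ ((2 %| M)%Z && (2 %| D)%Z) -> M != 0 -> M != D -> M != - D -> M != 3 * D ->
  infinitely_many (on_curve (- (M * D)) (M * D ^+ 3)).
Proof.
move=> MD_odd M0 MneD MneND Mne3D.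
(* The point 2P, in the coordinate U = D^2 u. *)
have on2P : on_curve (- (M * D)) (M * D ^+ 3) (((M - D) ^+ 2)%:~R / 4%:~R).
  exists ((M - D)%:~R * (M ^+ 2 - 4 * M * D - D ^+ 2)%:~R / 8).
  rewrite !(rmorphN, rmorphB, rmorphM, rmorphXn) /=.
  by field.
have [odd_sub|even_sub] := boolP (oddz (M - D)).
  have p_odd := oddz_sqr odd_sub.
  apply: infinitely_many_on_curve on2P _ _ _ => //; first exact: oddz_sqrB.
  exact/oddz_neq0/oddz_quadratic.
have [d DE] : exists d, D = 2 * d + 1.
  by apply/oddzP; move: MD_odd even_sub; rewrite /oddz; lia.
have [e ME] : exists e, M = D + 2 * e.
  by exists ((M - D) %/ 2)%Z; move: even_sub; rewrite /oddz; lia.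
(* M and D are odd from here on. If M = D mod 4, then 2P has the even integral coordinate 4 h^2
   while b is odd, so 4P has even denominator. Otherwise 2P has an odd integral coordinate and 3P is
   used. *)
have [h [hE|hE]] : exists h, e = 2 * h \/ e = 2 * h + 1.
  by exists (e %/ 2)%Z; lia.
  have h0 : h != 0 by apply: contraNneq MneD => h0; rewrite ME hE h0; apply/eqP; ring.
  have {}ME : M = D + 4 * h by rewrite ME hE; ring.
  apply: (@infinitely_many_on_curve _ _ (4 * h ^+ 2) 1) => //.
  - have -> : (4 * h ^+ 2)%:~R / 1%:~R = ((M - D) ^+ 2)%:~R / 4%:~R :> rat.
      by rewrite ME !(rmorphN, rmorphB, rmorphD, rmorphM, rmorphXn) /=; field.
    exact: on2P.
  - apply/oddzP; rewrite ME DE.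
    exists (8 * h ^+ 4 - (2 * h * (2 * d + 1) ^+ 3 + 8 * d ^+ 4 + 16 * d ^+ 3 + 12 * d ^+ 2 + 4 * d) - 1).
    ring.
  - rewrite mulf_neq0 ?mulf_neq0 ?expf_neq0 //.
    apply/oddz_neq0/oddzP; rewrite ME DE.
    exists (8 * h ^+ 4 - 2 * (D + 4 * h) * D * h ^+ 2 + 2 * h * D ^+ 3
      + (8 * d ^+ 4 + 16 * d ^+ 3 + 12 * d ^+ 2 + 4 * d)).
    by rewrite DE; ring.
have {h hE}[h hE] : exists h, e = 2 * h - D.
  by exists (h + d + 1); rewrite hE DE; ring.
have {}ME : M = 4 * h - D by rewrite ME hE; ring.
have [g gE] : exists g, h * (h - D) = 2 * g.
  have [g [gE|gE]] : exists g, h = 2 * g \/ h = 2 * g + 1 by exists (h %/ 2)%Z; lia.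
    by exists (g * (h - D)); rewrite gE; ring.
  by exists (h * (g - d)); rewrite DE gE; ring.
(* h = (M + D) / 4 and h - D = (M - 3 D) / 4, so g = 0 exactly in the excluded cases M = -D and M =
   3 D. *)
have g0 : g != 0.
  apply/eqP => g0; move/eqP: gE; rewrite g0 mulr0 mulf_eq0 subr_eq0 => /orP[/eqP h0|/eqP hD].
    by move/eqP: MneND; apply; rewrite ME h0; ring.
  by move/eqP: Mne3D; apply; rewrite ME hD; ring.
have D_odd : oddz D by apply/oddzP; exists d.
have w_odd : oddz (2 * h ^+ 2 - M * D).
  apply/oddzP; exists (h ^+ 2 - 2 * h * D + 2 * d ^+ 2 + 2 * d); rewrite ME DE; ring.
set w := 2 * h ^+ 2 - M * D in w_odd.
have D0 := oddz_neq0 D_odd; have w0 := oddz_neq0 w_odd.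
have M_odd : oddz M.
  by apply/oddzP; exists (2 * h - d - 1); rewrite ME DE; ring.
have MDw_odd : oddz (M * D * D ^+ 2 * (w ^+ 2) ^+ 2).
  by rewrite !oddzM ?oddz_sqr.
(* The point 3P. *)
apply: (@infinitely_many_on_curve _ _ (16 * D * M * g ^+ 2) (w ^+ 2)).
- exists (D%:~R * M%:~R * (4 * g%:~R / w%:~R) *
    ((D ^+ 5 - 8 * h * D ^+ 4 + 22 * h ^+ 2 * D ^+ 3 - 28 * h ^+ 3 * D ^+ 2
     + 12 * h ^+ 4 * D)%:~R / w%:~R ^+ 2)).
  have wr : w%:~R != 0 :> rat by rewrite intr_eq0.
  have gE' : h%:~R * (h%:~R - D%:~R) = 2 * g%:~R :> rat.
    by rewrite -rmorphB -rmorphM gE rmorphM.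
  have gE2 : g%:~R = h%:~R * (h%:~R - D%:~R) / 2 :> rat by rewrite gE'; field.
  have wE : w%:~R = 2 * h%:~R ^+ 2 - (4 * h%:~R - D%:~R) * D%:~R :> rat by rewrite /w ME; ring.
  rewrite rmorphM !rmorphXn /= rmorphM /= gE2 wE ME.
  by rewrite wE in wr; field.
(* 3P has even numerator and odd denominator, and b is odd, so the double 6P has odd numerator. *)
- have -> : (16 * D * M * g ^+ 2) ^+ 2 - M * D ^+ 3 * (w ^+ 2) ^+ 2 =
    2 * (128 * (D * M * g ^+ 2) ^+ 2) - M * D * D ^+ 2 * (w ^+ 2) ^+ 2 by ring.
  exact: oddz_double_sub.
- by rewrite expf_neq0.
- rewrite !mulf_neq0 ?expf_neq0 //.
  have -> : (16 * D * M * g ^+ 2) ^+ 2 + - (M * D) * (16 * D * M * g ^+ 2) * w ^+ 2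
      + M * D ^+ 3 * (w ^+ 2) ^+ 2 =
    2 * (128 * (D * M * g ^+ 2) ^+ 2 - 8 * (D * M * g * w) ^+ 2
      + M * D * D ^+ 2 * (w ^+ 2) ^+ 2) - M * D * D ^+ 2 * (w ^+ 2) ^+ 2 by ring.
  exact/oddz_neq0/oddz_double_sub.
Qed.

(** * The torsion cases m = 1, -1, 3 *)

(* The points below come from a computer search: (-2/3, -93/52, -21/19),
   (2/3, -18/11, -5/2) and (-1/6, -19/37, -28/3) are the (z, x, y) found for
   k = 1, -1, 1/3; z is replaced by k/z.  Large constants are written as
   expressions because numerals are unary. *)
Lemma lau_sol_1 : infinitely_many (lau_sol 1).
Proof.
apply: (@lau_sol_fixed_z_int _ (- (3 / 2)) 36
  (10 ^+ 4 + 537) (84 ^+ 4) (3567 ^+ 2) (8 ^+ 2)).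
- by [].
- by [].
- by [].
- by [].
- by [].
- by rewrite /lau; field.
- by rewrite /lau; field.
- by exists (3567 * (13064 * 10 ^+ 3 + 127) / 512); field.
- by apply: oddz_sqrB; first exact: oddz_sqr.
- by [].
- by apply/oddz_neq0/oddz_quadratic; first exact: oddz_sqr.
Qed.

Lemma lau_sol_N1 : infinitely_many (lau_sol (- 1)).
Proof.
apply: (@lau_sol_fixed_z_int _ (- (3 / 2)) 36
  (32 * 10 ^+ 3 + 329) (12 ^+ 4) 27 1).
- by [].
- by [].
- by [].
- by [].
- by [].
- by rewrite /lau; field.
- by rewrite /lau; field.
- by exists (27 * 182); field.
- by apply/oddzP; exists (364 - 6 * 12 ^+ 3); ring.
- by [].
- by lia.
Qed.

Lemma lau_sol_third : infinitely_many (lau_sol (1 / 3)).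
Proof.
apply: (@lau_sol_fixed_z_int _ (- 2) 36
  (- 983) (2352 ^+ 2) (3 * 3479 ^+ 2) (13 ^+ 2)).
- by [].
- by [].
- by [].
- by [].
- by [].
- by rewrite /lau; field.
- by rewrite /lau; field.
- by exists (3479 * 6 * (10458 * 10 ^+ 3 + 511) / 13 ^+ 3); field.
(* Here q is odd but b is even; a factor 2 is moved from b into q to fit [oddz_sqrB]. *)
- have -> : (3 * 3479 ^+ 2) ^+ 2 - 2352 ^+ 2 * (13 ^+ 2) ^+ 2 =
    (3 * 3479 ^+ 2) ^+ 2 - 1176 ^+ 2 * (2 * 13 ^+ 2) ^+ 2 :> int by ring.
  apply: oddz_sqrB; first exact/oddzM/oddz_sqr.
  exact: dvdz_mulr.
- by [].
- by lia.
Qed.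

(** * Assembly *)

Lemma numq_denq_odd (x : rat) : ~~ ((2 %| numq x)%Z && (2 %| denq x)%Z).
Proof.
apply/negP => /andP[num_even den_even].
have := coprime_num_den x; rewrite /coprime => /eqP gcd1.
have : (2 %| gcdn `|numq x| `|denq x|)%N by rewrite dvdn_gcd; apply/andP.
by rewrite gcd1.
Qed.

Lemma infinitely_many_lau_sol (k : rat) : k != 0 -> infinitely_many (lau_sol k).
Proof.
move=> k0; set M := numq k^-1; set D := denq k^-1.
have kE : k = D%:~R / M%:~R.
  by rewrite -[LHS]invrK -[X in X^-1]divq_num_den invf_div.
have M0 : M != 0 by rewrite numq_eq0 invr_eq0.
have D0 : D != 0 by rewrite denq_neq0.
have Mr : M%:~R != 0 :> rat by rewrite intr_eq0.
have Dr : D%:~R != 0 :> rat by rewrite intr_eq0.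
have MD_odd : ~~ ((2 %| M)%Z && (2 %| D)%Z) := numq_denq_odd _.
clearbody M D.
have [MD|MneD] := eqVneq M D.
  by rewrite kE MD divff //; apply: lau_sol_1.
have [MD|MneND] := eqVneq M (- D).
  by rewrite kE MD rmorphN invrN mulrN divff //; apply: lau_sol_N1.
have [MD|Mne3D] := eqVneq M (3 * D).
  have -> : k = 1 / 3 by rewrite kE MD rmorphM /=; field.
  exact: lau_sol_third.
have inf_E := infinitely_many_product_curve MD_odd M0 MneD MneND Mne3D.
rewrite kE -invf_div; apply: lau_sol_geometric; first by rewrite mulf_neq0 ?invr_eq0.
set m := M%:~R / D%:~R.
have mE : M%:~R = m * D%:~R by rewrite /m; field.
suff inf_t : infinitely_many (fun t => exists y, y ^+ 2 = 1 ^+ 2 * t ^+ 4 + 0 * t ^+ 3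
    + (- 4 * m) * t ^+ 2 + (8 * m) * t + (- 4 * m)).
  apply: (infinitely_many_image (f := id) (g := id) inf_t) => // t [y yE].
  by exists y; rewrite yE; ring.
apply: infinitely_many_quartic => //.
(* The resolvent is V^2 = U^3 - 4 m U^2 + 16 m U; U = 4 u / D^2 and V = 8 v / D^3 turn it into the
   integral curve. *)
apply: (infinitely_many_affine (a := 4 / D%:~R ^+ 2) (b := 0) _ inf_E) => [|u [v vE]].
  by rewrite mulf_neq0 ?invr_eq0 ?expf_neq0.
exists (8 * v / D%:~R ^+ 3).
rewrite expr_div_n exprMn vE !(rmorphN, rmorphM, rmorphXn) /= mE.
by field.
Qed.

(* "infinitely many": no finite list contains all nontrivial solutions *)
Theorem theorem1p3 (A B C : int) (hABC : A * B * C != 0) :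
  forall s : seq (rat * rat * rat),
    exists t : rat * rat * rat, nontrivial_sol A B C t /\ t \notin s.
Proof.
move=> s; have k0 : (A * C)%:~R / B%:~R ^+ 2 != 0 :> rat.
  have := hABC; rewrite mulf_eq0 negb_or mulf_eq0 negb_or -andbA => /and3P[A0 B0 C0].
  by rewrite mulf_neq0 ?invr_eq0 ?expf_neq0 ?intr_eq0 ?mulf_neq0.
by have [t] := lau_sol_scale hABC (infinitely_many_lau_sol k0) s; exists t.
Qed.
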